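(* Let $(C_{\leq_C},\alpha,\gamma,A_{\leq_A})$ be a Galois insertion, where $\langle C,\leq_C\rangle$ is a complete lattice, and let $f:C\to C$ be a monotonic function. Then: (a) $\mathrm{lfp}(f)=\gamma(\mathrm{lfp}(\alpha f\gamma))$ if and only if for all $c'\in C$: $\big(\mathrm{lfp}(f)\leq_C c'\iff\exists a\in A.\ f(\gamma(a))\leq_C\gamma(a)\wedge\gamma(a)\leq_C c'\big)$; (b) $\alpha(\mathrm{lfp}(f))=\mathrm{lfp}(\alpha f\gamma)$ if and only if for all $a'\in A$: $\big(\mathrm{lfp}(f)\leq_C\gamma(a')\iff\exists a\in A.\ f(\gamma(a))\leq_C\gamma(a)\wedge\gamma(a)\leq_C\gamma(a')\big)$.
   Context: A Galois connection between posets $\langle C,\leq_C\rangle$ and $\langle A,\leq_A\rangle$ is a pair of maps $\alpha:C\to A$, $\gamma:A\to C$ with $\alpha(c)\leq_A a\iff c\leq_C\gamma(a)$ for all $c\in C,a\in A$; it is a Galois insertion when $\alpha$ is surjective (equivalently, $\gamma$ is injective). $\alpha f\gamma$ denotes $\alpha\circ f\circ\gamma:A\to A$, and $\mathrm{lfp}(g)$ denotes the least fixpoint of $g$. *)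

(* Defs.v *)
From mathcomp Require Import all_boot all_order.
From mathcomp Require Import boolp classical_sets functions.

Set Implicit Arguments.
Unset Strict Implicit.
Unset Printing Implicit Defensive.

Local Open Scope classical_set_scope.
Local Open Scope order_scope.

(* [S] ranges over all subsets, including [set0]: hence [C] has a bottom and a
   top, and is in particular inhabited. *)
Definition complete_lattice d (C : porderType d) : Prop :=
  forall S : set C, supremums S !=set0 /\ infimums S !=set0.

Definition galois_connection dC dA (C : porderType dC) (A : porderType dA)
    (alpha : C -> A) (gamma : A -> C) : Prop :=
  forall (c : C) (a : A), alpha c <= a <-> c <= gamma a.

Definition galois_insertion dC dA (C : porderType dC) (A : porderType dA)
    (alpha : C -> A) (gamma : A -> C) : Prop :=
  galois_connection alpha gamma /\ set_surj [set: C] [set: A] alpha.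

Definition is_lfp d (T : porderType d) (g : T -> T) (x : T) : Prop :=
  g x = x /\ forall y : T, g y = y -> x <= y.

(* The least fixpoint of [g], unique by antisymmetry; as in
   [classical_sets.supremum], the default [x0] is only the value taken when [g]
   has no least fixpoint. *)
Definition lfp d (T : porderType d) (x0 : T) (g : T -> T) : T :=
  xget x0 [set x | is_lfp g x].

(* Main.v *)
(* The infima of [C] transport to [A] along the insertion, so by Knaster-Tarski
   [n = lfp (alpha \o f \o gamma)] is the least [a] with
   [f (gamma a) <= gamma a]. Hence the existential conditions just say
   [gamma n <= c'] and [n <= a'], and both equivalences compare elements
   through their upper bounds. *)
Require Import Defs.
From mathcomp Require Import all_boot all_order.
From mathcomp Require Import boolp classical_sets functions.

Import Order.TTheory.

Local Open Scope classical_set_scope.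
Local Open Scope order_scope.

(** Knaster-Tarski: the infimum [m] of all prefixpoints is a prefixpoint, hence so is [g m], which
    forces [g m = m]. A least fixpoint thus exists, so [lfp] never takes its default [x0]. *)
Lemma lfp_least_prefixpoint d (T : porderType d) (x0 : T) (g : T -> T) :
  (forall S : set T, infimums S !=set0) -> {homo g : x y / x <= y} ->
  g (lfp x0 g) = lfp x0 g /\ forall y, g y <= y -> lfp x0 g <= y.
Proof.
move=> inf_ex g_mono.
have [m [m_lb m_glb]] := inf_ex [set y | g y <= y].
have gm_le : g m <= m.
  by apply: m_glb => y /= gy; apply: le_trans (gy); apply/g_mono/m_lb.
have gmE : g m = m.
  by apply/eqP; rewrite eq_le gm_le; apply/m_lb/g_mono.
have m_lfp : is_lfp g m by split=> // y gy; apply: m_lb; rewrite /= gy.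
have [lfp_fix lfp_le] : is_lfp g (lfp x0 g) by exact: (xgetPex x0 (ex_intro _ m m_lfp)).
by split=> // y gy; apply: le_trans (lfp_le _ gmE) (m_lb _ gy).
Qed.

Section GaloisInsertion.
Variables (dC dA : Order.disp_t) (C : porderType dC) (A : porderType dA).
Variables (alpha : C -> A) (gamma : A -> C).
Hypothesis GI : galois_insertion alpha gamma.

Lemma galois_le_gamma_alpha c : c <= gamma (alpha c).
Proof. exact/(GI.1 c). Qed.

Lemma galois_alpha_homo : {homo alpha : x y / x <= y}.
Proof.
by move=> x y xy; apply/(GI.1 x)/(le_trans xy)/galois_le_gamma_alpha.
Qed.

Lemma galois_gamma_homo : {homo gamma : x y / x <= y}.
Proof.
by move=> x y xy; apply/(GI.1 _ y); apply: le_trans xy; apply/(GI.1 _ x).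
Qed.

Lemma galois_insertionK : cancel gamma alpha.
Proof.
move=> a; have [c _ <-] := GI.2 a I.
apply/eqP; rewrite eq_le; apply/andP; split; first exact/(GI.1 _ (alpha c)).
exact/galois_alpha_homo/galois_le_gamma_alpha.
Qed.

(** The infimum of [S] is [alpha] of an infimum of its image under [gamma]; a lower bound [b] is
    compared with it after rewriting [b] as [alpha (gamma b)]. *)
Lemma galois_insertion_infimums :
  (forall S : set C, infimums S !=set0) -> forall S : set A, infimums S !=set0.
Proof.
move=> inf_ex S; have [m [m_lb m_glb]] := inf_ex (gamma @` S).
exists (alpha m); split=> [a Sa|b b_lb].
  by apply/(GI.1 m); apply: m_lb; exists a.
rewrite -[b]galois_insertionK; apply: galois_alpha_homo.
by apply: m_glb => _ [a Sa <-]; apply/galois_gamma_homo/b_lb.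
Qed.

End GaloisInsertion.

Theorem theorem3p6 (dC dA : Order.disp_t) (C : porderType dC) (A : porderType dA)
    (c0 : C) (a0 : A) (alpha : C -> A) (gamma : A -> C) (f : C -> C)
    (C_complete : complete_lattice C)
    (alpha_gamma_GI : galois_insertion alpha gamma)
    (f_mono : {homo f : x y / x <= y}) :
  (lfp c0 f = gamma (lfp a0 (alpha \o f \o gamma)) <->
   forall c' : C,
     (lfp c0 f <= c' <->
      exists a : A, f (gamma a) <= gamma a /\ gamma a <= c'))
  /\
  (alpha (lfp c0 f) = lfp a0 (alpha \o f \o gamma) <->
   forall a' : A,
     (lfp c0 f <= gamma a' <->
      exists a : A, f (gamma a) <= gamma a /\ gamma a <= gamma a')).
Proof.
have GC := alpha_gamma_GI.1.
have gammaK := galois_insertionK _ _ _ _ _ _ alpha_gamma_GI.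
have gamma_homo := galois_gamma_homo _ _ _ _ _ _ alpha_gamma_GI.
have alpha_homo := galois_alpha_homo _ _ _ _ _ _ alpha_gamma_GI.
have C_inf (S : set C) : infimums S !=set0 by have [] := C_complete S.
have A_inf := galois_insertion_infimums _ _ _ _ _ _ alpha_gamma_GI C_inf.
have g_mono : {homo alpha \o f \o gamma : x y / x <= y}.
  by move=> x y xy; apply/alpha_homo/f_mono/gamma_homo.
have [] := lfp_least_prefixpoint _ _ a0 _ A_inf g_mono.
(* From here on [n] is any least prefixpoint that is also a fixpoint, and [m] any element of [C]. *)
move: (lfp a0 _) (lfp c0 f) => n m n_fix n_le.
(* By adjunction [f (gamma a) <= gamma a] says that [a] is a prefixpoint of [alpha \o f \o gamma];
   the least such witness is [n]. *)
have prefixE c : (exists a, f (gamma a) <= gamma a /\ gamma a <= c) <->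
                 gamma n <= c.
  split=> [[a [/GC fa ac]]|nc]; first exact: le_trans (gamma_homo _ _ (n_le a fa)) ac.
  by exists n; split=> //; apply/GC; rewrite -[X in _ <= X]n_fix.
have gammaE a : gamma n <= gamma a <-> n <= a by rewrite -GC gammaK.
split; split=> [mn c|H].
- by rewrite prefixE mn.
(* The two inequalities are [H] at [gamma n] and at [m]. *)
- apply/eqP; rewrite eq_le; apply/andP; split.
    exact/H/prefixE.
  exact/prefixE/H.
- by rewrite prefixE gammaE -GC mn.
(* Here [H] only tests bounds in the image of [gamma]: it is used at [n], then at [alpha m]. *)
- apply/eqP; rewrite eq_le; apply/andP; split.
    exact/GC/H/prefixE.
  by apply/gammaE/prefixE/H/GC.
Qed.
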